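(* For an isosceles trapezoidal central configuration of four bodies with reflection symmetry $\sigma=(1\;2)(3\;4)$, $\rho=\operatorname{diag}(-1,1)$, the two terms in the splitting $H_{\mathcal C}=L^\Delta+\widetilde L$ are separately invariant under the rooted-coordinate action $$R=\begin{pmatrix}-\rho&\mathbf 0&\mathbf 0\\-\rho&\mathbf 0&\rho\\-\rho&\rho&\mathbf 0\end{pmatrix}\in\mathbb R^{6\times6},$$ that is, $$R^TL^\Delta R=L^\Delta,\qquad R^T\widetilde LR=\widetilde L.$$
   Context: Four bodies have masses $m_1,\dots,m_4>0$, $M=\sum_i m_i$, pairwise distinct positions $\mathbf r_i\in\mathbb R^2$ with $\sum_i m_i\mathbf r_i=0$; $\mathbf q_{ij}=\mathbf r_i-\mathbf r_j$, $q_{ij}=|\mathbf q_{ij}|$, $\hat{\mathbf q}_{ij}=\mathbf q_{ij}/q_{ij}$, $\mu_{ij}=m_im_j/M$. The configuration is central if there is $\omega^2>0$ with $\omega^2m_i\mathbf r_i=\sum_{j\ne i}\frac{m_im_j}{q_{ij}^3}\mathbf q_{ij}$ for all $i$ (such $\omega^2$ is then uniquely determined). Put $\alpha_{ij}^\perp=\alpha_{ji}^\perp=\mu_{ij}(\omega^2-M/q_{ij}^3)$, $\delta_{ij}=3M\mu_{ij}/q_{ij}^3$, $\mathbf D_{ij}=\mathbf D_{ji}=\delta_{ij}\hat{\mathbf q}_{ij}\hat{\mathbf q}_{ij}^T$. With indices $a,b\in\{2,3,4\}$ and sums over $k\in\{1,2,3,4\}$, $k\ne a$: $\ell\in\mathbb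 R^{3\times3}$ is $\ell_{a-1,a-1}=\sum_{k\ne a}\alpha_{ak}^\perp$, $\ell_{a-1,b-1}=-\alpha_{ab}^\perp$ $(a\ne b)$; $\widetilde L=\ell\otimes\mathbf I_2\in\mathbb R^{6\times6}$; $L^\Delta\in\mathbb R^{6\times6}$ is the $3\times3$ array of $2\times2$ blocks $(L^\Delta)_{a-1,a-1}=\sum_{k\ne a}\mathbf D_{ak}$, $(L^\Delta)_{a-1,b-1}=-\mathbf D_{ab}$ $(a\neq b)$; $H_{\mathcal C}=L^\Delta+\widetilde L$. Isosceles trapezoidal setting: the bodies are the vertices of a convex isosceles trapezoid labelled counterclockwise, with bodies $1,2$ forming the lower base and bodies $3,4$ the upper base, the symmetry axis being the $y$-axis: $\mathbf r_2=\rho\mathbf r_1$, $\mathbf r_4=\rho\mathbf r_3$, $m_1=m_2$, $m_3=m_4$, with $\rho=\operatorname{diag}(-1,1)$. The matrix $R$ acts on $\mathbf u=(\mathbf u_{12},\mathbf u_{13},\mathbf u_{14})\in(\mathbb R^2)^3$ by $R\mathbf u=(-\rho\mathbf u_{12},\ \rho(\mathbf u_{14}-\mathbf u_{12}),\ \rho(\mathbf u_{13}-\mathbf u_{12}))$. *)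

(* Defs.v *)
From HB Require Import structures.
From mathcomp Require Import all_boot all_order all_algebra all_fingroup.
From mathcomp Require Import reals mxtens.

Set Implicit Arguments.
Unset Strict Implicit.
Unset Printing Implicit Defensive.

Import Order.TTheory GRing.Theory Num.Theory.
Local Open Scope ring_scope.

(* The bodies 1, 2, 3, 4 are the elements 0, 1, 2, 3 of 'I_4. *)
Definition b1 : 'I_4 := @Ordinal 4 0 isT.
Definition b2 : 'I_4 := @Ordinal 4 1 isT.
Definition b3 : 'I_4 := @Ordinal 4 2 isT.
Definition b4 : 'I_4 := @Ordinal 4 3 isT.

Section FourBodies.
Variable R : realType.
Implicit Types (m : 'I_4 -> R) (r : 'I_4 -> 'cV[R]_2) (wsq : R) (i j k : 'I_4).

(* Euclidean norm: the norm MathComp puts on matrices is the sup norm. *)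
Definition enorm n (v : 'cV[R]_n) : R := Num.sqrt (\sum_i v i 0 ^+ 2).

Definition total_mass m : R := \sum_i m i.
Definition reduced_mass m i j : R := m i * m j / total_mass m.

Definition rel_pos r i j : 'cV[R]_2 := r i - r j.
Definition rel_dist r i j : R := enorm (rel_pos r i j).
Definition rel_dir r i j : 'cV[R]_2 := (rel_dist r i j)^-1 *: rel_pos r i j.

Record configuration m r : Prop := Configuration {
  mass_gt0 : forall i, 0 < m i;
  position_inj : injective r;
  barycenter0 : \sum_i m i *: r i = 0 }.

(* [wsq] stands for omega^2. *)
Definition central_configuration m r wsq : Prop :=
  [/\ configuration m r, 0 < wsq &
      forall i, (wsq * m i) *: r i =
        \sum_(j | j != i) (m i * m j / rel_dist r i j ^+ 3) *: rel_pos r i j].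

Definition alpha_perp m r wsq i j : R :=
  reduced_mass m i j * (wsq - total_mass m / rel_dist r i j ^+ 3).
Definition delta m r i j : R :=
  3 * total_mass m * reduced_mass m i j / rel_dist r i j ^+ 3.
Definition Dmx m r i j : 'M[R]_2 :=
  delta m r i j *: (rel_dir r i j *m (rel_dir r i j)^T).

(* The 3 x 3 array of 2 x 2 blocks [B a b], of size 3 * 2; the index
   convention is that of the Kronecker product [*t]. *)
Definition blocks3 (B : 'I_3 -> 'I_3 -> 'M[R]_2) : 'M[R]_(3 * 2) :=
  \matrix_(i, j) B (mxtens_unindex i).1 (mxtens_unindex j).1
                   (mxtens_unindex i).2 (mxtens_unindex j).2.

Definition stack3 (u : 'I_3 -> 'cV[R]_2) : 'cV[R]_(3 * 2) :=
  \col_i u (mxtens_unindex i).1 (mxtens_unindex i).2 0.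

(* The row (or column) [a : 'I_3] corresponds to the body [lift ord0 a],
   which ranges over the bodies 2, 3, 4. *)
Definition rooted_body (a : 'I_3) : 'I_4 := lift ord0 a.

Definition ell m r wsq : 'M[R]_3 :=
  \matrix_(a, b)
    if a == b then \sum_(k | k != rooted_body a)
                     alpha_perp m r wsq (rooted_body a) k
    else - alpha_perp m r wsq (rooted_body a) (rooted_body b).

Definition Ltilde m r wsq : 'M[R]_(3 * 2) := ell m r wsq *t (1%:M : 'M[R]_2).

Definition LDelta m r : 'M[R]_(3 * 2) :=
  blocks3 (fun a b =>
    if a == b then \sum_(k | k != rooted_body a) Dmx m r (rooted_body a) k
    else - Dmx m r (rooted_body a) (rooted_body b)).

Definition HC m r wsq : 'M[R]_(3 * 2) := LDelta m r + Ltilde m r wsq.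

Definition rho : 'M[R]_2 := diag_mx (\row_j if j == 0 then -1 else 1).

Definition sigma : 'S_4 := (tperm b1 b2 * tperm b3 b4)%g.

Definition reflection_symmetric m r : Prop :=
  forall i, r (sigma i) = rho *m r i /\ m (sigma i) = m i.

(* Twice the signed area of the triangle x y z. *)
Definition orient (x y z : 'cV[R]_2) : R :=
  (y - x) 0 0 * (z - x) 1 0 - (y - x) 1 0 * (z - x) 0 0.

(* [r] lists counterclockwise the vertices of a strictly convex polygon: every
   other vertex is strictly to the left of each directed edge. *)
Definition convex_ccw r : Prop :=
  forall i j, j != i -> j != ordS i -> 0 < orient (r i) (r (ordS i)) (r j).

(* The bases are the edges 12 and 34; the reflection symmetry makes them
   perpendicular to the y-axis, hence parallel, and makes the legs congruent. *)
Record isosceles_trapezoidal m r : Prop := IsoscelesTrapezoidal {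
  trapezoid_convex : convex_ccw r;
  trapezoid_sym : reflection_symmetric m r;
  trapezoid_lower : r b1 1 0 < r b3 1 0 }.

Definition Ract : 'M[R]_(3 * 2) :=
  blocks3 (fun a b =>
    nth 0 (nth [::] [:: [:: - rho;   0;   0];
                        [:: - rho;   0; rho];
                        [:: - rho; rho;   0]] a) b).

Lemma reflection_symmetricP m r :
  reflection_symmetric m r <->
  [/\ r b2 = rho *m r b1, r b4 = rho *m r b3, m b1 = m b2 & m b3 = m b4].
Proof.
have s1 : sigma b1 = b2 by rewrite permM tpermL tpermD.
have s2 : sigma b2 = b1 by rewrite permM tpermR tpermD.
have s3 : sigma b3 = b4 by rewrite permM (@tpermD _ b1) // tpermL.
have s4 : sigma b4 = b3 by rewrite permM (@tpermD _ b1) // tpermR.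
have rhoK (v : 'cV[R]_2) : rho *m (rho *m v) = v.
  rewrite mulmxA mulmx_diag -[RHS]mul1mx -diag_const_mx; congr (diag_mx _ *m _).
  by apply/rowP => j; rewrite !mxE; case: ifP; rewrite ?mulrNN mulr1.
split=> [sym|[r12 r34 m12 m34] i].
  have [] := sym b1; have [] := sym b3; rewrite s1 s3 => -> -> -> ->.
  by split.
have: [|| i == b1, i == b2, i == b3 | i == b4] by case: i => [[|[|[|[|]]]]].
by case/or4P=> /eqP ->; rewrite ?(s1, s2, s3, s4) ?r12 ?r34 ?rhoK.
Qed.

Lemma blocks3_stack3 B u :
  blocks3 B *m stack3 u = stack3 (fun a => \sum_b B a b *m u b).
Proof.
apply/colP => i; rewrite !mxE summxE.
under [RHS]eq_bigr do rewrite mxE.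
rewrite pair_bigA /= (reindex (@mxtens_index 3 2)) /=; last first.
  by exists (@mxtens_unindex 3 2) => x _; rewrite (mxtens_indexK, mxtens_unindexK).
by apply: eq_bigr => -[b l] _; rewrite !mxE mxtens_indexK.
Qed.

Lemma RactE (u12 u13 u14 : 'cV[R]_2) :
  Ract *m stack3 (fun a => nth 0 [:: u12; u13; u14] a) =
  stack3 (fun a => nth 0 [:: - (rho *m u12);
                             rho *m (u14 - u12);
                             rho *m (u13 - u12)] a).
Proof.
rewrite blocks3_stack3; apply/colP => i; rewrite [LHS]mxE [RHS]mxE.
congr (fun_of_matrix _ _ 0); move: (mxtens_unindex i).1 => a.
rewrite !big_ord_recl big_ord0 /= addr0.
by case: a => [[|[|[|//]]] ?] /=;
  rewrite ?mulmxBr ?mul0mx ?mulNmx ?addr0 ?add0r // addrC.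
Qed.

End FourBodies.

Arguments rho {R}.
Arguments Ract {R}.

(* Main.v *)
Require Import Defs.
From mathcomp Require Import all_boot all_order all_algebra all_fingroup.
From mathcomp Require Import reals mxtens.
Import Order.TTheory GRing.Theory Num.Theory.
Local Open Scope ring_scope.

(* Both terms are Laplacians of the complete graph on the bodies, with 2 x 2
   matrix weights [W i j = W j i], grounded at body 1: with [P i] the projection
   onto the coordinates of body [i] ([P b1 = 0]), they equal
   [\sum_i \sum_j (P i)^T *m W i j *m (P i - P j)].  Since [Ract] moves body [i]
   like [rho *m (P (sigma i) - P b2)], it maps [P i - P j] to
   [rho *m (P (sigma i) - P (sigma j))], and invariance reduces to
   [W (sigma i) (sigma j) = rho *m W i j *m rho], reindexing the sum by [sigma].
   The ground term [P b2] contributes nothing because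
   [\sum_i \sum_j W i j *m (P i - P j) = 0]. *)

Section RootedLaplacian.
Variable R : realType.
Implicit Types (W : 'I_4 -> 'I_4 -> 'M[R]_2) (i j k : 'I_4).

(** The blocks copy the form of [LDelta], so [LDelta m r] is convertible to
    [rooted_laplacian (Dmx m r)]. *)
Definition rooted_laplacian W : 'M[R]_(3 * 2) :=
  blocks3 (fun a b =>
    if a == b then \sum_(k | k != rooted_body a) W (rooted_body a) k
    else - W (rooted_body a) (rooted_body b)).

Definition block_row (B : 'I_3 -> 'M[R]_2) : 'M[R]_(2, 3 * 2) :=
  \matrix_(s, y) B (mxtens_unindex y).1 s (mxtens_unindex y).2.

(** No [rooted_body b] equals [b1], so [body_proj b1] is zero without a separate case. *)
Definition body_proj i : 'M[R]_(2, 3 * 2) :=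
  block_row (fun b => (i == rooted_body b)%:R%:M).

Lemma block_row_blocks3 B C :
  block_row B *m blocks3 C = block_row (fun b => \sum_a B a *m C a b).
Proof.
apply/matrixP => s y; rewrite !mxE summxE.
under [RHS]eq_bigr do rewrite mxE.
rewrite pair_bigA /= (reindex (@mxtens_index 3 2)) /=; last first.
  by exists (@mxtens_unindex 3 2) => x _; rewrite (mxtens_indexK, mxtens_unindexK).
by apply: eq_bigr => -[b l] _; rewrite !mxE mxtens_indexK.
Qed.

Lemma mul_block_row (A : 'M[R]_2) B :
  A *m block_row B = block_row (fun b => A *m B b).
Proof.
by apply/matrixP => s y; rewrite !mxE; apply: eq_bigr => k _; rewrite mxE.
Qed.

Lemma block_rowB B C :
  block_row (fun b => B b - C b) = block_row B - block_row C.
Proof. by apply/matrixP => s y; rewrite !mxE. Qed.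

Lemma eq_block_row B C : B =1 C -> block_row B = block_row C.
Proof. by move=> eqBC; apply/matrixP => s y; rewrite !mxE eqBC. Qed.

Lemma mul_body_proj (A : 'M[R]_2) i j (x y : 'I_(3 * 2)) :
  ((body_proj i)^T *m A *m body_proj j) x y =
  (i == rooted_body (mxtens_unindex x).1)%:R *
  (j == rooted_body (mxtens_unindex y).1)%:R *
  A (mxtens_unindex x).2 (mxtens_unindex y).2.
Proof.
rewrite -mulmxA mul_block_row mxE (bigD1 (mxtens_unindex x).2) //= big1 => [|s ns].
  by rewrite addr0 [in X in _ * X]mxE mul_mx_scalar !mxE eqxx mulr1n mulrA.
by rewrite !mxE (negPf ns) mulr0n mul0r.
Qed.

Lemma rooted_laplacianE W :
  rooted_laplacian W =
  \sum_i \sum_j (body_proj i)^T *m W i j *m (body_proj i - body_proj j).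
Proof.
apply/matrixP => x y; rewrite [LHS]mxE [RHS]summxE.
set a := (mxtens_unindex x).1; set b := (mxtens_unindex y).1.
set s := (mxtens_unindex x).2; set t := (mxtens_unindex y).2.
(* In row block [a] the left factor [(body_proj i)^T] vanishes unless [i] is [rooted_body a]. *)
rewrite [RHS](bigD1 (rooted_body a)) //= [X in _ = _ + X]big1 ?addr0; last first.
  move=> i ni; rewrite summxE big1 // => j _.
  by rewrite mulmxBr mxE [X in _ + X]mxE !mul_body_proj (negPf ni) !mul0r subrr.
rewrite [RHS]summxE.
under [RHS]eq_bigr => j _.
  rewrite mulmxBr mxE [X in _ + X]mxE !mul_body_proj -/a -/b -/s -/t eqxx !mul1r.
  over.
have eq_body c d : (rooted_body c == rooted_body d) = (c == d).
  by rewrite (inj_eq lift_inj).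
rewrite sumrB [X in _ - X](bigD1 (rooted_body b)) //=.
rewrite [X in _ - (_ + X)]big1; last by move=> j nj; rewrite (negPf nj) mul0r.
rewrite eqxx mul1r addr0 eq_body; case: eqP => [<-|_].
  (* On a diagonal block the subtracted weight cancels the self-weight [j = rooted_body a] of the
     full sum. *)
  rewrite summxE [in RHS](bigD1 (rooted_body a)) //= mul1r addrAC subrr add0r.
  by apply: eq_bigr => j _; rewrite mul1r.
by rewrite big1 ?add0r ?mxE // => j _; rewrite mul0r.
Qed.

Lemma sigmaE : [/\ sigma b1 = b2, sigma b2 = b1, sigma b3 = b4 & sigma b4 = b3].
Proof.
split.
- by rewrite permM tpermL tpermD.
- by rewrite permM tpermR tpermD.
- by rewrite permM (@tpermD _ b1) // tpermL.
- by rewrite permM (@tpermD _ b1) // tpermR.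
Qed.

Lemma trmx_rho : rho^T = rho :> 'M[R]_2.
Proof. exact: tr_diag_mx. Qed.

Lemma rho_invol : rho *m rho = 1%:M :> 'M[R]_2.
Proof.
rewrite mulmx_diag -diag_const_mx; congr diag_mx.
by apply/rowP => j; rewrite !mxE; case: ifP; rewrite ?mulrNN mulr1.
Qed.

(** Since [sigma] sends the root [b1] to [b2], subtracting [body_proj b2] puts the root back at
    zero. The identity is then checked block by block for each body. *)
Lemma body_proj_Ract i :
  body_proj i *m Ract = rho *m (body_proj (sigma i) - body_proj b2).
Proof.
have [s1 s2 s3 s4] := sigmaE.
rewrite block_row_blocks3 -block_rowB mul_block_row.
apply: eq_block_row => b.
have: [|| i == b1, i == b2, i == b3 | i == b4] by case: i => [[|[|[|[|]]]]].
rewrite !big_ord_recl big_ord0 /= mulmxBr !mul_scalar_mx !mul_mx_scalar.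
case/or4P=> /eqP ->; rewrite ?(s1, s2, s3, s4);
by case: b => [[|[|[|//]]] ?]; rewrite /= ?(scale0r, scale1r, scaler0,
  subrr, addr0, add0r, subr0, sub0r).
Qed.

Lemma rooted_laplacian_Ract W :
    (forall i j, W i j = W j i) ->
    (forall i j, W (sigma i) (sigma j) = rho *m W i j *m rho) ->
  Ract^T *m rooted_laplacian W *m Ract = rooted_laplacian W.
Proof.
move=> symW sigmaW; rewrite rooted_laplacianE.
pose Z i := \sum_j W i j *m (body_proj i - body_proj j).
have sumZ0 : \sum_i Z i = 0.
  have -> : \sum_i Z i = \sum_i \sum_j W i j *m body_proj i
                        - \sum_i \sum_j W i j *m body_proj j.
    rewrite -sumrB; apply: eq_bigr => i _; rewrite -sumrB.
    by apply: eq_bigr => j _; rewrite mulmxBr.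
  (* Swapping the two summations turns one half into the other, because the weights are
     symmetric. *)
  rewrite [X in _ - X]exchange_big /=; apply/eqP; rewrite subr_eq0; apply/eqP.
  by apply: eq_bigr => i _; apply: eq_bigr => j _; rewrite symW.
have lapZ : \sum_i \sum_j (body_proj i)^T *m W i j *m (body_proj i - body_proj j)
            = \sum_i (body_proj i)^T *m Z i.
  apply: eq_bigr => i _; rewrite mulmx_sumr.
  by apply: eq_bigr => j _; rewrite mulmxA.
(* The shifts by [body_proj b2] cancel in the difference of two projections. *)
have ZR i : Z i *m Ract = rho *m Z (sigma i).
  rewrite mulmx_suml mulmx_sumr [RHS](reindex_perm sigma) /=.
  apply: eq_bigr => j _; rewrite sigmaW -!mulmxA mulmxBl !body_proj_Ract.
  rewrite -mulmxBr opprB addrA subrK.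
  by rewrite [RHS]mulmxA rho_invol mul1mx.
rewrite lapZ mulmx_sumr mulmx_suml.
(* The [rho] from the transposed projection cancels the one from [ZR]. *)
transitivity (\sum_i (body_proj i - body_proj b2)^T *m Z i).
  rewrite [RHS](reindex_perm sigma) /=; apply: eq_bigr => i _.
  rewrite mulmxA -trmx_mul body_proj_Ract trmx_mul trmx_rho -mulmxA ZR.
  by rewrite !mulmxA -[_ *m rho *m rho]mulmxA rho_invol mulmx1.
under eq_bigr do rewrite linearB /= mulmxBl.
by rewrite sumrB -mulmx_sumr sumZ0 mulmx0 subr0.
Qed.

Section Weights.
Variables (m : 'I_4 -> R) (r : 'I_4 -> 'cV[R]_2) (wsq : R).

(** A Kronecker product with the identity has scalar 2 x 2 blocks. *)
Lemma Ltilde_laplacian :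
  Ltilde m r wsq = rooted_laplacian (fun i j => (alpha_perp m r wsq i j)%:M).
Proof.
apply/matrixP => x y; rewrite !mxE; case: eqP => _.
  by rewrite summxE mulr_suml; apply: eq_bigr => j _; rewrite mxE mulr_natr.
by rewrite !mxE mulNr mulr_natr.
Qed.

Lemma rel_posC i j : rel_pos r j i = - rel_pos r i j.
Proof. by rewrite /rel_pos opprB. Qed.

Lemma rel_distC i j : rel_dist r j i = rel_dist r i j.
Proof.
rewrite /rel_dist /enorm rel_posC; congr Num.sqrt.
by apply: eq_bigr => k _; rewrite mxE sqrrN.
Qed.

Lemma reduced_massC i j : reduced_mass m j i = reduced_mass m i j.
Proof. by rewrite /reduced_mass (mulrC (m j)). Qed.

Lemma alpha_perpC i j : alpha_perp m r wsq j i = alpha_perp m r wsq i j.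
Proof. by rewrite /alpha_perp rel_distC reduced_massC. Qed.

(** Reversing the pair negates both factors of the outer product. *)
Lemma DmxC i j : Dmx m r j i = Dmx m r i j.
Proof.
rewrite /Dmx /delta /rel_dir rel_distC reduced_massC rel_posC scalerN.
by rewrite linearN /= mulmxN mulNmx opprK.
Qed.

Lemma enorm_rho (v : 'cV[R]_2) : enorm (rho *m v) = enorm v.
Proof.
congr Num.sqrt; apply: eq_bigr => k _; rewrite mul_diag_mx !mxE.
by case: ifP; rewrite ?mulN1r ?mul1r ?sqrrN.
Qed.

Hypothesis sym : reflection_symmetric m r.

Lemma rel_pos_sigma i j : rel_pos r (sigma i) (sigma j) = rho *m rel_pos r i j.
Proof. by rewrite /rel_pos (sym i).1 (sym j).1 mulmxBr. Qed.

Lemma rel_dist_sigma i j : rel_dist r (sigma i) (sigma j) = rel_dist r i j.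
Proof. by rewrite /rel_dist rel_pos_sigma enorm_rho. Qed.

Lemma rel_dir_sigma i j : rel_dir r (sigma i) (sigma j) = rho *m rel_dir r i j.
Proof. by rewrite /rel_dir rel_dist_sigma rel_pos_sigma scalemxAr. Qed.

Lemma reduced_mass_sigma i j :
  reduced_mass m (sigma i) (sigma j) = reduced_mass m i j.
Proof. by rewrite /reduced_mass (sym i).2 (sym j).2. Qed.

Lemma alpha_perp_sigma i j :
  alpha_perp m r wsq (sigma i) (sigma j) = alpha_perp m r wsq i j.
Proof. by rewrite /alpha_perp rel_dist_sigma reduced_mass_sigma. Qed.

(** The outer product of [rho *m v] with itself is [rho *m (v *m v^T) *m rho^T], and [rho] is
    symmetric; masses and distances are preserved. *)
Lemma Dmx_sigma i j :
  Dmx m r (sigma i) (sigma j) = rho *m Dmx m r i j *m rho.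
Proof.
rewrite /Dmx /delta rel_dir_sigma rel_dist_sigma reduced_mass_sigma.
by rewrite -[in RHS]scalemxAr -[in RHS]scalemxAl trmx_mul trmx_rho !mulmxA.
Qed.

End Weights.
End RootedLaplacian.

Theorem proposition6p2 (R : realType) (m : 'I_4 -> R) (r : 'I_4 -> 'cV[R]_2)
    (wsq : R)
    (hcentral : central_configuration m r wsq)
    (htrapezoid : isosceles_trapezoidal m r) :
  [/\ HC m r wsq = LDelta m r + Ltilde m r wsq,
      Ract^T *m LDelta m r *m Ract = LDelta m r &
      Ract^T *m Ltilde m r wsq *m Ract = Ltilde m r wsq].
Proof.
have sym := trapezoid_sym htrapezoid; split=> [//||].
  apply: (@rooted_laplacian_Ract R (Dmx m r)) => i j; first exact: DmxC.
  exact: Dmx_sigma.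
rewrite Ltilde_laplacian; apply: rooted_laplacian_Ract => i j.
  by rewrite alpha_perpC.
(* Scalar weights commute with [rho], whose square is the identity. *)
by rewrite alpha_perp_sigma // mul_mx_scalar -scalemxAl rho_invol scalemx1.
Qed.
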